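(* Let $k\in\mathbb{N}$ and $d\geq\binom{k+1}{2}$. The Hermitian Gram spectrahedron $\mathcal{H}^{+}(f)$ of a generic nonnegative binary form $f\in\mathbb{R}[x,y]_{2d}$ contains a face $F$ which is a simplex, with $(\mathrm{rk}(F),\dim(F))=(k+1,k)$, and such that every extreme point of $F$ is a tensor of rank one.
   Context: $\mathbb{N}=\{1,2,3,\dots\}$. $\mathbb{K}[x,y]_m$ denotes the space of binary forms of degree $m$ over $\mathbb{K}$ (together with $0$). A form $f\in\mathbb{R}[x,y]_{2d}$ is nonnegative if $f(a,b)\ge 0$ for all $(a,b)\in\mathbb{R}^2$. ''For a generic nonnegative binary form $f\in\mathbb{R}[x,y]_{2d}$, property P holds'' means: the set of nonnegative $f\in\mathbb{R}[x,y]_{2d}$ for which P fails is contained in some (algebraic) hypersurface of the real vector space $\mathbb{R}[x,y]_{2d}$. Let $V=\mathbb{C}[x,y]_d$ and let $p\mapsto\overline{p}$ be complex conjugation of coefficients. Let $\mathsf{H}_2V$ be the real vector space of Hermitian tensors, i.e. the elements of $V\otimes_{\mathbb{C}}\overline{V}$ fixed by the antilinear involution $v\otimes\overline{w}\mapsto w\otimes\overline{v}$. Let $\mu:\mathsf{H}_2V\to\mathbb{C}[x,y]_{2d}$ be the $\mathbb{R}$-linear map induced by $p\otimes\overline{q}\mapsto p\overline{q}$. Every $\theta\in\mathsf{H}_2V$ can be written as $\theta=\sum_{j=1}^r\epsilon_j\, p_j\otimes\overline{p_j}$ with $\epsilon_j=\pm1$ and $p_1,\dots,p_r\in V$ linearly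 independent over $\mathbb{C}$; then $\mathrm{im}(\theta)=\mathrm{span}_{\mathbb{C}}(p_1,\dots,p_r)$, $\mathrm{rk}(\theta)=r$, and $\theta$ is positive semidefinite (psd) if all $\epsilon_j=1$. The Hermitian Gram spectrahedron is $\mathcal{H}^{+}(f)=\{\theta\in\mathsf{H}_2V:\theta\text{ psd},\ \mu(\theta)=f\}$. For a nonempty face $F$ of $\mathcal{H}^{+}(f)$ put $\mathscr{U}(F)=\sum_{\theta\in F}\mathrm{im}(\theta)\subseteq V$ and $\mathrm{rk}(F)=\dim_{\mathbb{C}}\mathscr{U}(F)$ (this equals $\mathrm{rk}(\theta)$ for every $\theta$ in the relative interior of $F$). *)

(* Defs.v *)
From HB Require Import structures.
From mathcomp Require Import all_boot all_order all_algebra.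
From mathcomp Require Import classical_sets reals complex mpoly.

Set Implicit Arguments.
Unset Strict Implicit.
Unset Printing Implicit Defensive.

Import Order.TTheory GRing.Theory Num.Theory.

Local Open Scope classical_set_scope.
Local Open Scope ring_scope.

Section ConvexGeometry.
Variables (R : numDomainType) (E : lmodType R).
Implicit Types (K F : set E) (x y z : E) (t : R).

Definition is_convex F : Prop := forall x y t,
  F x -> F y -> 0 <= t <= 1 -> F (t *: x + (1 - t) *: y).

Definition is_face K F : Prop :=
  [/\ F `<=` K, is_convex F
    & forall x y t, K x -> K y -> 0 < t < 1 ->
        F (t *: x + (1 - t) *: y) -> F x /\ F y].

Definition extreme_point K x : Prop :=
  K x /\ forall y z t, K y -> K z -> 0 < t < 1 ->
           x = t *: y + (1 - t) *: z -> y = x /\ z = x.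

Definition affinely_independent m (v : 'I_m -> E) : Prop :=
  forall c : 'I_m -> R, \sum_i c i = 0 -> \sum_i c i *: v i = 0 ->
    forall i, c i = 0.

Definition affine_hull m (v : 'I_m -> E) : set E :=
  [set x | exists c : 'I_m -> R, \sum_i c i = 1 /\ x = \sum_i c i *: v i].

Definition convex_hull m (v : 'I_m -> E) : set E :=
  [set x | exists c : 'I_m -> R,
     [/\ forall i, 0 <= c i, \sum_i c i = 1 & x = \sum_i c i *: v i]].

(* The dimension of a nonempty convex set is that of its affine hull; the empty
   set satisfies [has_dim] for no n. *)
Definition has_dim F n : Prop :=
  exists v : 'I_n.+1 -> E,
    [/\ affinely_independent v, forall i, F (v i) & F `<=` affine_hull v].

Definition is_simplex F : Prop :=
  exists n (v : 'I_n.+1 -> E), affinely_independent v /\ F = convex_hull v.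

End ConvexGeometry.

Notation binform K m := (dhomog 2 K m).

(* The exponent of the monomial x^i y^(m-i), for i <= m. *)
Definition binmon (m i : nat) : 'X_{1..2} :=
  [multinom (if j == ord0 then i else m - i)%N | j < 2].

Lemma binformE (K : nzRingType) m (p : binform K m) :
  (p : {mpoly K[2]}) =
  \sum_(i < m.+1) (p : {mpoly K[2]})@_(binmon m i) *: 'X_[binmon m i].
Proof.
apply/mpolyP => e; rewrite raddf_sum /=.
under eq_bigr => i _ do rewrite mcoeffZ mcoeffX.
have eD : mdeg e = (e ord0 + e ord_max)%N.
  rewrite mdegE big_ord_recl big_ord1; congr (_ + e _)%N; exact: val_inj.
have [em|em] := eqVneq (mdeg e) m; last first.
  rewrite (dhomog_nemf_coeff (dhomog_is_dhomog p) em) big1 // => i _.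
  case: eqP => [ei|_]; last by rewrite mulr0.
  by case/eqP: em; rewrite eD -ei !mnmE /= subnKC // -ltnS.
have lt0 : (e ord0 < m.+1)%N by rewrite ltnS -em eD leq_addr.
have ee : binmon m (Ordinal lt0) = e.
  apply/mnmP => j; rewrite mnmE /=.
  case: eqP => [->//|/eqP j0]; rewrite -em eD addKn.
  by congr (e _); apply: val_inj; case: j j0 => [[|[|]]].
rewrite (bigD1 (Ordinal lt0)) //= ee eqxx mulr1 big1 ?addr0 // => i ne.
case: eqP => [ei|_]; last by rewrite mulr0.
by case/eqP: ne; apply: val_inj; rewrite /= -ei mnmE eqxx.
Qed.

Definition nonneg_form (R : realType) m (f : binform R m) : Prop :=
  forall a : 'I_2 -> R, 0 <= (f : {mpoly R[2]}).@[a].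

Definition hypersurface (R : realType) m (Z : set (binform R m)) : Prop :=
  exists h : {mpoly R[m.+1]}, (1 < msize h)%N /\
    Z = [set f | h.@[fun i : 'I_m.+1 => (f : {mpoly R[2]})@_(binmon m i)] = 0].

Definition generic_nonneg (R : realType) m (P : binform R m -> Prop) : Prop :=
  exists Z : set (binform R m), hypersurface Z /\
    [set f | nonneg_form f /\ ~ P f] `<=` Z.

(* V (x) conj V, for V = C[x,y]_d, is identified with (d+1) x (d+1) matrices
   through its basis m_i (x) conj m_j, where m_i = x^i y^(d-i).  The involution
   v (x) conj w |-> w (x) conj v becomes the conjugate transpose. *)
Section Tensors.
Variables (R : realType) (d : nat).
Local Notation C := R[i].

Definition tens (p q : binform C d) : 'M[C]_d.+1 :=
  \matrix_(i, j) ((p : {mpoly C[2]})@_(binmon d i)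
                  * ((q : {mpoly C[2]})@_(binmon d j))^*).

Definition tens_mul (A : 'M[C]_d.+1) : {mpoly C[2]} :=
  \sum_i \sum_j A i j *: ('X_[binmon d i] * 'X_[binmon d j]).

Lemma tens_mul_tens (p q : binform C d) :
  tens_mul (tens p q) =
  (p : {mpoly C[2]}) * map_mpoly Num.conj (q : {mpoly C[2]}).
Proof.
rewrite [in RHS](binformE p) [in RHS](binformE q) rmorph_sum /= mulr_suml.
apply: eq_bigr => i _; rewrite mulr_sumr; apply: eq_bigr => j _.
by rewrite mxE map_mpolyZ map_mpolyX -scalerAl -scalerAr scalerA.
Qed.

Record herm_tensor := HermTensor {
  herm_mx :> 'M[C]_d.+1;
  _ : herm_mx \is hermsymmx }.

HB.instance Definition _ := [isSub for herm_mx].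
HB.instance Definition _ := [Choice of herm_tensor by <:].

Fact hermsymmx_zmod_closed : zmod_closed (@hermitianmx C d.+1 false Num.conj).
Proof.
split=> [|A B].
  by apply/is_hermitianmxP; rewrite trmx0 map_mx0 scaler0.
move=> /is_hermitianmxP hA /is_hermitianmxP hB; apply/is_hermitianmxP.
rewrite expr0 !scale1r in hA hB *.
by rewrite linearB /= map_mxB -hA -hB.
Qed.

HB.instance Definition _ := GRing.isZmodClosed.Build 'M[C]_d.+1
  (has_quality 0 (@hermitianmx C d.+1 false Num.conj)) hermsymmx_zmod_closed.
HB.instance Definition _ := [SubChoice_isSubZmodule of herm_tensor by <:].

Fact herm_scale_subproof (a : R) (A : herm_tensor) :
  (a%:C)%C *: (A : 'M[C]_d.+1) \is hermsymmx.
Proof.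
case: A => A /= /is_hermitianmxP hA; apply/is_hermitianmxP.
rewrite expr0 !scale1r in hA *.
rewrite linearZ /= map_mxZ -hA; congr (_ *: _).
by apply/eqP; rewrite eq_complex /= oppr0 !eqxx.
Qed.

Definition herm_scale (a : R) (A : herm_tensor) : herm_tensor :=
  HermTensor (herm_scale_subproof a A).

Fact herm_scaleA a b A : herm_scale a (herm_scale b A) = herm_scale (a * b) A.
Proof. by apply: val_inj; rewrite /= scalerA -rmorphM. Qed.
Fact herm_scale1 : left_id 1 herm_scale.
Proof. by move=> A; apply: val_inj; rewrite /= scale1r. Qed.
Fact herm_scaleDr : right_distributive herm_scale +%R.
Proof. by move=> a A B; apply: val_inj; rewrite /= scalerDr. Qed.
Fact herm_scaleDl A : {morph herm_scale^~ A : a b / a + b}.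
Proof. by move=> a b; apply: val_inj; rewrite /= rmorphD scalerDl. Qed.

HB.instance Definition _ := GRing.Zmodule_isLmodule.Build R herm_tensor
  herm_scaleA herm_scale1 herm_scaleDr herm_scaleDl.

Implicit Types (theta : herm_tensor) (s : seq (bool * binform C d))
  (F : set herm_tensor).

(* theta = \sum_j eps_j p_j (x) conj p_j with (p_j) linearly independent, where
   s lists the pairs (b_j, p_j) and eps_j = (-1) ^ b_j. *)
Definition herm_decomp theta s : Prop :=
  free (unzip2 s) /\
  herm_mx theta = \sum_(u <- s) (-1) ^+ u.1 *: tens u.2 u.2.

Definition has_rank theta (r : nat) : Prop :=
  exists s, herm_decomp theta s /\ size s = r.

Definition psd theta : Prop :=
  exists s, herm_decomp theta s /\ all (fun u => ~~ u.1) s.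

Definition tens_im theta : set (binform C d) :=
  [set v | exists s, herm_decomp theta s /\ v \in <<unzip2 s>>%VS].

Definition face_space F : set (binform C d) :=
  [set v | exists n (theta : 'I_n -> herm_tensor) (w : 'I_n -> binform C d),
     [/\ forall i, F (theta i), forall i, tens_im (theta i) (w i)
       & v = \sum_i w i]].

Definition has_face_rank F (r : nat) : Prop :=
  exists U : {vspace binform C d}, [set` U] = face_space F /\ \dim U = r.

Definition gram_spectrahedron (f : binform R (2 * d)) : set herm_tensor :=
  [set theta | psd theta /\
     tens_mul theta = map_mpoly (real_complex R) (f : {mpoly R[2]})].

End Tensors.

(* Main.v *)
(** Write f(x,1) = c \prod_(t < d) (x - w_t)(x - conj w_t).  Conjugating some of
    the roots w_t gives forms p with p conj p = f.  Let S_m be the m consecutive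
    indices from 'C(m, 2) on and, for m <= k, let p_m conjugate the roots w_t
    with t in S_m; the rank one tensors p_m (x) conj p_m are the vertices of the
    face.  A positive semidefinite tensor in the smallest face containing them is
    \sum c_ij p_i (x) conj p_j with c Hermitian and \sum c_ij p_i conj p_j = f.
    At w_t with t in S_m only the terms i = m survive, so once the c_ij with
    max(i,j) > m are known to vanish, the m points of S_m give a square linear
    system for the c_mj, j < m, whose matrix (conj p_j (w_t)) does not depend on
    the c_ij.  By descending induction on m, c is diagonal, hence the face is a
    simplex.  Only the distinctness of the roots and the invertibility of these
    matrices are used.  Both are a nonvanishing condition for a polynomial in the
    2d roots; the product of its images under all permutations of the roots is a
    polynomial in the coefficients of f. *)

From HB Require Import structures.
Require Import Defs.
From mathcomp Require Import all_boot all_order all_algebra all_fingroup.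
From mathcomp Require Import classical_sets reals polyrcf complex mpoly.
From mathcomp Require Import ring lra zify.

Set Implicit Arguments.
Unset Strict Implicit.
Unset Printing Implicit Defensive.

Import Order.TTheory GRing.Theory Num.Theory.

Local Open Scope classical_set_scope.
Local Open Scope ring_scope.

(** * Nonnegative real polynomials and conjugate pairs of roots *)

Lemma poly_ge0_at (R : rcfType) (Q : {poly R}) (a : R) :
  (forall t, a < t -> 0 <= Q.[t]) -> 0 <= Q.[a].
Proof.
move=> Qge0; rewrite leNgt; apply/negP => Qa_lt0.
have [|e e_gt0 /(_ (a + e / 2))] := @poly_cont _ a Q (- Q.[a]).
  by rewrite oppr_gt0.
rewrite (addrC a) addrK ger0_norm; last by rewrite divr_ge0 // ltW.
have lt_e : e / 2 < e by lra.
move=> /(_ lt_e); have := Qge0 (e / 2 + a).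
have -> : a < e / 2 + a by lra.
move=> /(_ isT) Q_ge0; rewrite ger0_norm; lra.
Qed.

(** Writing F = (X - a) Q, the factor Q is nonnegative to the right of a and nonpositive to the
    left, so Q(a) = 0 by continuity. *)
Lemma nonneg_poly_double_root (R : rcfType) (F : {poly R}) (a : R) :
  (forall t, 0 <= F.[t]) -> root F a -> ('X - a%:P) ^+ 2 %| F.
Proof.
move=> Fge0 /factor_theorem [Q FE]; rewrite FE expr2 dvdp_mul2r ?polyXsubC_eq0 //.
rewrite dvdp_XsubCl; apply/eqP/le_anti/andP; split.
  (* The reflection t -> -t turns the limit from the left into one from the right. *)
  rewrite -oppr_ge0 -[a in Q.[a]]opprK.
  suff: 0 <= (- (Q \Po - 'X)).[- a] by rewrite hornerN horner_comp !hornerE.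
  apply: poly_ge0_at => t lt_at; rewrite hornerN horner_comp !hornerE.
  have := Fge0 (- t); rewrite FE !hornerE nmulr_lge0; last lra.
  by rewrite oppr_ge0.
apply: poly_ge0_at => t lt_at.
by have := Fge0 t; rewrite FE !hornerE pmulr_lge0 // subr_gt0.
Qed.

(** Induction on d: a complex root and its conjugate are split off together as one real quadratic
    factor q, and the quotient is again nonnegative. *)
Lemma nonneg_poly_factor (R : rcfType) d (F : {poly R}) :
    (forall t, 0 <= F.[t]) -> size F = (2 * d).+1 ->
  exists w : nat -> R[i], map_poly (real_complex R) F =
    (lead_coef F)%:C%C *: \prod_(0 <= t < d)
       (('X - (w t)%:P) * ('X - ((w t)^*)%:P)).
Proof.
elim: d F => [|d IHd] F Fge0 sF.
  exists (fun=> 0); rewrite big_geq // (size1_polyC (eq_leq sF)).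
  by rewrite lead_coefC map_polyC -alg_polyC.
have [w rw] : exists w, root (map_poly (real_complex R) F) w.
  by apply/closed_rootP; rewrite size_map_poly sF.
pose a := complex.Re w; pose b := complex.Im w.
pose q : {poly R} := ('X - a%:P) ^+ 2 + (b ^+ 2)%:P.
have qE : map_poly (real_complex R) q = ('X - w%:P) * ('X - (w^*)%:P).
  rewrite rmorphD rmorphXn rmorphB /= map_polyX !map_polyC /=.
  have -> : w^* = (a%:C - 'i * b%:C)%C.
    by rewrite /a /b; case: (w) => x y; simpc.
  have -> : w = (a%:C + 'i * b%:C)%C.
    by rewrite /a /b; case: (w) => x y; simpc.
  have i2 : 'i%C * 'i%C = - 1 :> R[i].
    by apply/eqP; rewrite eq_complex /=; apply/andP; split; apply/eqP; ring.
  rewrite !(polyCD, polyCM, polyCN, rmorphXn) /=.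
  have i2P : ('i%C)%:P * ('i%C)%:P = - 1 :> {poly R[i]} by rewrite -polyCM i2 polyCN.
  by ring: i2P.
have sq : size q = 3%N.
  by rewrite size_polyDl ?size_exp_XsubC // size_polyC; case: eqP.
have mq : q \is monic.
  rewrite monicE lead_coefDl ?lead_coef_exp ?lead_coefXsubC ?expr1n //.
  by rewrite size_exp_XsubC size_polyC; case: eqP.
(* A real root is at least double by nonnegativity; a nonreal one comes with its conjugate. *)
have dvd_q : q %| F.
  have [b0|b0] := eqVneq b 0.
    rewrite /q b0 expr0n polyC0 addr0; apply: nonneg_poly_double_root => //.
    rewrite -(fmorph_root (real_complex R)) /=.
    by have -> : (a%:C)%C = w by
      rewrite /a; move: b0; rewrite /b; case: (w) => ? ? /= ->.
  rewrite -(dvdp_map (real_complex R)) qE Gauss_dvdp; last first.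
    rewrite coprimep_XsubC root_XsubC.
    apply: contra b0 => /eqP/(congr1 (@complex.Im _)).
    rewrite /b; case: (w) => x y /= yN; apply/eqP; lra.
  rewrite !dvdp_XsubCl rw /=.
  have := complex_root_conj (map_poly (real_complex R) F) w.
  rewrite -map_poly_comp (eq_map_poly (g := real_complex R)).
    by rewrite rw => /esym.
  by move=> x; exact: conjc_real.
have [Q FE] : exists Q, F = Q * q by apply/dvdpP.
have Q0 : Q != 0 by apply: contra_eq_neq sF => Q0; rewrite FE Q0 mul0r size_poly0.
have Qge0 t : 0 <= Q.[t].
  have Qt u : u != a -> 0 <= Q.[u].
    move=> ua; have := Fge0 u; rewrite FE hornerM pmulr_lge0 //.
    rewrite !hornerE ltr_pwDl ?sqr_ge0 // lt_neqAle sqr_ge0 andbT eq_sym.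
    by rewrite sqrf_eq0 subr_eq0.
  (* At t = a the factor q may vanish, so the sign of Q there comes from continuity. *)
  have [->|/Qt//] := eqVneq t a.
  by apply: poly_ge0_at => u au; rewrite Qt // gt_eqF.
have sQ : size Q = (2 * d).+1.
  by move: sF; rewrite FE size_Mmonic // sq; lia.
have [w' w'E] := IHd Q Qge0 sQ.
exists (fun t => if t is t'.+1 then w' t' else w).
rewrite FE rmorphM /= w'E qE big_nat_recl //= lead_coef_Mmonic //.
by rewrite -scalerAl [in RHS]mulrC.
Qed.

(** * From conditions on roots to conditions on coefficients *)

Section Symmetrization.
Variables (R : idomainType) (n : nat) (D : {mpoly R[n]}).

Definition symmetrized : {mpoly R[n]} := \prod_(s : 'S_n) msym s D.

Lemma symmetrized_sym : symmetrized \is symmetric.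
Proof.
apply/issymP => s'; rewrite /symmetrized rmorph_prod /=.
rewrite [RHS](reindex_inj (mulIg s')).
by apply: eq_bigr => s _; rewrite msymMm.
Qed.

Lemma symmetrized_neq0 : D != 0 -> symmetrized != 0.
Proof.
move=> D0; apply/prodf_neq0 => s _; apply: contra_neq D0 => sD0.
by rewrite -(msym1m D) -(mulgV s) msymMm sD0 msym0.
Qed.

Lemma mmap_symmetrized_eq0 (S : idomainType) (f : {rmorphism R -> S})
    (z : 'I_n -> S) : mmap f z D = 0 -> mmap f z symmetrized = 0.
Proof.
by move=> D0; rewrite rmorph_prod (bigD1 1%g) //= msym1m D0 mul0r.
Qed.

Definition rev_coef (i : 'I_n) : 'I_n.+1 := widen_ord (leqnSn n) (rev_ord i).

(* The coefficient of x^(n-i-1) is (-1)^(i+1) times the leading one times the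
   elementary symmetric function of degree i+1; [N - mdeg m] must not truncate,
   so the lemmas assume [msize t <= N].  The extra leading variable forces the
   leading coefficient to be nonzero. *)
Definition homogenized (N : nat) (t : {mpoly R[n]}) : {mpoly R[n.+1]} :=
  'X_ord_max * \sum_(m <- msupp t) t@_m *:
    ('X_ord_max ^+ (N - mdeg m) *
     \prod_(i < n) ((-1) ^+ i.+1 * 'X_(rev_coef i)) ^+ m i).

(** Here [u] stands for the elementary symmetric functions of the roots and [v] for the
    coefficients, tied by Vieta's formulas. A monomial of degree e yields the e-th power of the
    leading coefficient, which is then completed to the N-th; the extra variable gives one more. *)
Lemma mmap_homogenized (S : comNzRingType) (f : {rmorphism R -> S})
    (u : 'I_n -> S) (v : 'I_n.+1 -> S) N (t : {mpoly R[n]}) :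
    (msize t <= N)%N ->
    (forall i : 'I_n, (-1) ^+ i.+1 * v (rev_coef i) = v ord_max * u i) ->
  mmap f v (homogenized N t) = v ord_max ^+ N.+1 * mmap f u t.
Proof.
move=> tN vE; rewrite /homogenized rmorphM /= mmapX mmap1U exprS -mulrA.
congr (_ * _); rewrite rmorph_sum /= [mmap f u t]/mmap mulr_sumr.
rewrite [LHS]big_seq [RHS]big_seq; apply: eq_bigr => m m_t.
rewrite mmapZ rmorphM rmorphXn /= mmapX mmap1U rmorph_prod /= [RHS]mulrCA.
congr (_ * _); rewrite /mmap1.
rewrite (eq_bigr (fun i => v ord_max ^+ m i * u i ^+ m i)) => [|i _]; last first.
  by rewrite rmorphXn rmorphM rmorphXn rmorphN1 /= mmapX mmap1U vE exprMn.
rewrite big_split /= mulrA prodrXr -mdegE -exprD subnK //.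
by rewrite (leq_trans _ tN) // ltnW // msize_mdeg_lt.
Qed.

(** Nonconstancy makes the zero set a hypersurface. A constant value would be 0, as seen at the
    origin, and then t would vanish at the elementary symmetric polynomials. *)
Lemma homogenized_msize N (t : {mpoly R[n]}) :
  (msize t <= N)%N -> t \mPo [tuple mesym n R i.+1 | i < n] != 0 ->
  (1 < msize (homogenized N t))%N.
Proof.
move=> tN; rewrite ltnNge; apply: contra_neqN => /msize1_polyC hC.
have h0 : homogenized N t = 0.
  rewrite hC; have := congr1 (meval (fun=> 0)) hC.
  by rewrite mevalC [in LHS]mevalM mevalXU mul0r => <-; rewrite mpolyC0.
(* The coefficients of the monic polynomial whose roots are the variables. *)
pose v (j : 'I_n.+1) : {mpoly R[n]} := (-1) ^+ (n - j) * mesym n R (n - j).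
have := @mmap_homogenized _ (@mpolyC n R)
  (tnth [tuple mesym n R i.+1 | i < n]) v N t tN.
rewrite h0 mmap0 /v /= subnn mesym0E !mul1r expr1n mul1r /comp_mpoly => <- // i.
rewrite subKn // tnth_mktuple mulrA -exprD addnn -muln2 exprM sqrr_sign.
by rewrite mul1r.
Qed.

End Symmetrization.

(** The symmetrization of D is a polynomial t in the elementary symmetric functions, and h is t
    homogenized. If D vanished at the roots z, Vieta's formulas would give h(c) = 0. *)
Lemma coeff_condition_of_roots (R S : fieldType) (f : {rmorphism R -> S})
    n (D : {mpoly R[n]}) : D != 0 ->
  exists2 h : {mpoly R[n.+1]}, (1 < msize h)%N &
    forall c : 'I_n.+1 -> R, h.@[c] != 0 -> c ord_max != 0 /\
      forall z : 'I_n -> S,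
        \sum_(i < n.+1) f (c i) *: 'X^i =
          f (c ord_max) *: \prod_(i < n) ('X - (z i)%:P) ->
        mmap f z D != 0.
Proof.
move=> D0; have [t [tE _]] := sym_fundamental (symmetrized_sym D).
exists (homogenized (msize t) t).
  by rewrite homogenized_msize // tE symmetrized_neq0.
move=> c hc; have cn0 : c ord_max != 0.
  by apply: contra_neq hc => cn0; rewrite mevalM mevalXU cn0 mul0r.
split=> // z cE; apply: contra_neq hc => Dz0.
apply: (fmorph_inj f); rewrite rmorph0.
have -> : f (homogenized (msize t) t).@[c] =
    mmap f (f \o c) (homogenized (msize t) t).
  rewrite mevalE /mmap rmorph_sum; apply: eq_bigr => m _.
  by rewrite rmorphM rmorph_prod; congr (_ * _); apply: eq_bigr => i _;
    rewrite rmorphXn.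
rewrite (@mmap_homogenized _ _ _ f (fun i => (mesym n S i.+1).@[z])) //; last first.
  (* Vieta's formula for the coefficient of index n - i - 1; the sign cancels against its own
     square. *)
  move=> i; have := mroots_coeff [tuple z i | i < n] (lift ord0 i).
  rewrite big_tuple; under eq_bigr => j _ do rewrite tnth_mktuple.
  move=> /(congr1 (fun x => f (c ord_max) * x)); rewrite -coefZ -cE coef_sum.
  rewrite (bigD1 (rev_coef i)) //= coefZ coefXn.
  rewrite /bump /= add1n eqxx mulr1 big1 ?addr0; last first.
    move=> j ne; rewrite coefZ coefXn; case: eqP => [e|]; last by rewrite mulr0.
    by case/eqP: ne; apply: val_inj.
  move=> ->; rewrite mulrCA; congr (_ * _); rewrite mulrA -exprD addnn -muln2 exprM.
  by rewrite sqrr_sign mul1r; apply: meval_eq => j; rewrite tnth_mktuple.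
rewrite [X in _ * X](_ : _ = mmap f z (symmetrized D)).
  by rewrite mmap_symmetrized_eq0 // mulr0.
rewrite -tE /comp_mpoly [X in mmap f z X]/mmap rmorph_sum.
apply: eq_bigr => m _; rewrite rmorphM /= mmapC; congr (_ * _).
rewrite rmorph_prod; apply: eq_bigr => i _; rewrite rmorphXn tnth_mktuple.
congr (_ ^+ _); rewrite /mesym !rmorph_sum; apply: eq_bigr => A _.
rewrite !rmorph_prod; apply: eq_bigr => j _.
by rewrite /= mmapX mmap1U mevalXU.
Qed.

(** * Swapping roots along blocks, and the block matrices *)

(* Membership of t in the set S_m above; S_0 is empty. *)
Definition block (m t : nat) : bool := ('C(m, 2) <= t < 'C(m.+1, 2))%N.

Lemma bin2S m : 'C(m.+1, 2) = ('C(m, 2) + m)%N.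
Proof. by rewrite binS bin1. Qed.

Lemma block_inj i j t : block i t -> block j t -> i = j.
Proof.
move=> /andP[iL iU] /andP[jL jU]; apply/eqP; rewrite eqn_leq.
apply/andP; split; rewrite leqNgt; apply/negP => /(leq_bin2l 2); lia.
Qed.

Lemma block_first m : (0 < m)%N -> block m 'C(m, 2).
Proof. by rewrite /block bin2S; lia. Qed.

(** The bound on d enters here: the blocks up to S_k fit below d. *)
Lemma block_lt m t k d : block m t -> (m <= k)%N -> ('C(k.+1, 2) <= d)%N ->
  (t < d)%N.
Proof.
move=> /andP[_ tU] mk kd; apply: leq_trans kd; apply: leq_trans tU _.
exact: leq_bin2l.
Qed.

(** With a = w and b the conjugates this is p_m up to a scalar; exchanging a and b gives its
    conjugate. The ring is arbitrary because the roots are also taken to be variables or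
    integers. *)
Definition flip_poly (T : comNzRingType) d (a b : nat -> T) m : {poly T} :=
  \prod_(0 <= t < d) ('X - (if block m t then b t else a t)%:P).

(** The square system at the points of S_m: up to a scalar, entry (j, e) is conj p_j at the e-th
    point. For m = 0 the matrix is empty, with determinant 1. *)
Definition block_eval_mx (T : comNzRingType) d (a b : nat -> T) m : 'M[T]_m :=
  \matrix_(j < m, e < m) (flip_poly d b a j).[a ('C(m, 2) + e)%N].

Lemma horner_flip_poly (T : comNzRingType) d (a b : nat -> T) m x :
  (flip_poly d a b m).[x] =
  \prod_(0 <= t < d) (x - (if block m t then b t else a t)).
Proof. by rewrite horner_prod; apply: eq_bigr => t _; rewrite hornerXsubC. Qed.

Lemma flip_poly_root (T : comNzRingType) d (a b : nat -> T) m t :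
  (t < d)%N -> (flip_poly d a b m).[if block m t then b t else a t] = 0.
Proof.
move=> td; rewrite horner_flip_poly (bigD1_seq t) ?mem_index_iota ?iota_uniq //=.
by rewrite subrr mul0r.
Qed.

Lemma map_flip_poly (T U : comNzRingType) (f : {rmorphism T -> U}) d
    (a b : nat -> T) m :
  map_poly f (flip_poly d a b m) = flip_poly d (f \o a) (f \o b) m.
Proof.
rewrite rmorph_prod; apply: eq_bigr => t _.
by rewrite rmorphB /= map_polyX map_polyC /=; case: ifP.
Qed.

Lemma eq_flip_poly (T : comNzRingType) d (a b a' b' : nat -> T) m :
    (forall t, (t < d)%N -> a t = a' t) -> (forall t, (t < d)%N -> b t = b' t) ->
  flip_poly d a b m = flip_poly d a' b' m.
Proof.
by move=> aa' bb'; apply: eq_big_nat => t /andP[_ td]; rewrite aa' // bb'.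
Qed.

Lemma det_block_eval_mx_map (T U : comNzRingType) (f : {rmorphism T -> U}) d
    (a b : nat -> T) m :
  f (\det (block_eval_mx d a b m)) = \det (block_eval_mx d (f \o a) (f \o b) m).
Proof.
rewrite -det_map_mx; congr (\det _); apply/matrixP => j e.
by rewrite !mxE -horner_map map_flip_poly.
Qed.

Lemma eq_block_eval_mx (T : comNzRingType) d (a b a' b' : nat -> T) m :
    ('C(m.+1, 2) <= d)%N ->
    (forall t, (t < d)%N -> a t = a' t) -> (forall t, (t < d)%N -> b t = b' t) ->
  block_eval_mx d a b m = block_eval_mx d a' b' m.
Proof.
move=> md aa' bb'; apply/matrixP => j e; rewrite !mxE aa'.
  by rewrite (eq_flip_poly _ bb' aa').
by apply: leq_trans md; rewrite bin2S ltn_add2l.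
Qed.

(** The roots are later independent variables, so one numerical point shows that the determinant is
    a nonzero polynomial. *)
Lemma det_block_eval_mx_neq0 (R : numDomainType) d m : ('C(m.+1, 2) <= d)%N ->
  exists a b : nat -> R, \det (block_eval_mx d a b m) != 0.
Proof.
move=> md.
(* With a_('C(m,2)+e) = b_('C(e,2)) for e > 0, the factor of index 'C(e, 2) kills
   the entries (j, e) with j < e, while parity keeps the diagonal nonzero. *)
pose a t := if (t < 'C(m, 2))%N then t.*2 else
  if (t == 'C(m, 2))%N then 0%N else ('C(t - 'C(m, 2), 2).*2.+1)%N.
pose b t := t.*2.+1.
exists (fun t => (a t)%:R), (fun t => (b t)%:R).
have fE j e : (flip_poly d (fun t => (b t)%:R) (fun t => (a t)%:R) j).[(a e)%:R : R] =
    \prod_(0 <= t < d) ((a e)%:R - (if block j t then a t else b t)%:R).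
  by rewrite horner_flip_poly; apply: eq_bigr => t _; case: ifP.
have aE e : (e > 0)%N -> a ('C(m, 2) + e)%N = ('C(e, 2).*2.+1)%N.
  move=> e0; rewrite /a ltnNge leq_addr /= -[X in _ == X]addn0 eqn_add2l.
  by rewrite gtn_eqF // addKn.
rewrite det_trig; last first.
  apply/is_trig_mxP => j e je; rewrite mxE fE aE; last by lia.
  have e_block : block e 'C(e, 2) by apply: block_first; lia.
  have /(block_lt e_block)/(_ md) ed : (e <= m)%N by rewrite ltnW.
  rewrite (bigD1_seq 'C(e, 2)%N) ?mem_index_iota ?iota_uniq //=.
  case: ifP => [/(block_inj e_block) ej|_]; first by lia.
  by rewrite subrr mul0r.
apply/prodf_neq0 => j _; rewrite mxE fE prodf_seq_neq0; apply/allP => t _.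
rewrite implyTb subr_eq0 eqr_nat; have [->|j0] := posnP j.
  rewrite addn0 /a ltnn eqxx /block !bin0n /=.
  by rewrite /b.
rewrite aE //; case: ifP => [jt|jt].
  have tm : (t < 'C(m, 2))%N.
    have /andP[_ tj] := jt; apply: leq_trans tj _; exact: leq_bin2l.
  by rewrite /a tm; apply/negP => /eqP; lia.
(* Outside S_j, only the root of index 'C(j, 2) could equal the evaluation point, but that index
   lies in S_j. *)
apply/negP => /eqP tE; have tE' : t = 'C(j, 2) by move: tE; rewrite /b; lia.
by rewrite tE' block_first in jt.
Qed.

(** * Hermitian relations among the polynomials p_m *)

Section ConjugatePairs.
Variables (C : numClosedFieldType) (d k : nat) (w : nat -> C).
Hypothesis kd : ('C(k.+1, 2) <= d)%N.
Hypothesis w_inj : forall s t, (s < d)%N -> (t < d)%N -> s != t -> w s != w t.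
Hypothesis w_conj : forall s t, (s < d)%N -> (t < d)%N -> w s != (w t)^*.
Hypothesis w_block : forall m, (m <= k)%N ->
  \det (block_eval_mx d w (Num.conj \o w) m) != 0.

Let wc : nat -> C := Num.conj \o w.
Let p := flip_poly d w wc.
Let pc := flip_poly d wc w.

(** For t in S_m, the conjugate of w_t replaces w_t among the roots of p_m, and all 2d roots are
    distinct. *)
Lemma flip_horner_neq0 m t : (m <= k)%N -> block m t -> (p m).[w t] != 0.
Proof.
move=> mk mt; have td := block_lt mt mk kd.
rewrite horner_flip_poly prodf_seq_neq0; apply/allP => s.
rewrite mem_index_iota => /andP[_ sd]; rewrite implyTb subr_eq0.
case: ifP => [_|ms]; first exact: w_conj.
by apply: w_inj => //; apply: contraFneq ms => <-.
Qed.

Lemma flip_horner_eq0 i m t : (m <= k)%N -> block m t -> i != m ->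
  (p i).[w t] = 0.
Proof.
move=> mk mt im; have td := block_lt mt mk kd.
have := flip_poly_root w wc i td; case: ifP => // it.
by rewrite (block_inj it mt) eqxx in im.
Qed.

Lemma flipc_horner_eq0 m t : (m <= k)%N -> block m t -> (pc m).[w t] = 0.
Proof.
move=> mk mt; have td := block_lt mt mk kd.
by have := flip_poly_root wc w m td; rewrite mt.
Qed.

Lemma hermitian_relation_diag (c : 'M[C]_k.+1) :
    (forall i j, c j i = (c i j)^*) ->
    (forall t, (t < d)%N ->
      \sum_i \sum_j c i j * (p i).[w t] * (pc j).[w t] = 0) ->
  forall i j, i != j -> c i j = 0.
Proof.
move=> cH crel.
(* Descending induction on max(i, j): [r] counts the largest indices already settled, and r = 0 is
   vacuous. *)
suff H r (i j : 'I_k.+1) : i != j -> (k < r + maxn i j)%N -> c i j = 0.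
  by move=> i j /(H k.+1); apply; rewrite addSn ltnS leq_addr.
elim: r i j => [|r IHr] i j ij.
  by have := ltn_ord i; have := ltn_ord j; lia.
wlog ji : i j ij / (j < i)%N => [hw|].
  have := ij; rewrite -val_eqE neq_ltn => /orP[ji|ji] kr; last exact: hw.
  by rewrite maxnC in kr; rewrite cH (hw j i) ?conjC0 // eq_sym.
rewrite (maxn_idPl (ltnW ji)) => kri.
have ik : (i <= k)%N by rewrite -ltnS.
(* The unknowns left of the diagonal in row i; the invertible block matrix is shown to kill them. *)
pose v := \row_(l < i) c i (widen_ord (ltnW (ltn_ord i)) l).
suff v0 : v = 0.
  have := congr1 (fun u : 'rV_i => u 0 (Ordinal ji)) v0; rewrite !mxE => <-.
  by congr (c i _); apply: val_inj.
have M_unit : block_eval_mx d w wc i \in unitmx by rewrite unitmxE unitfE w_block.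
apply: (can_inj (mulmxK M_unit)); rewrite mul0mx; apply/rowP => e.
have it : block i ('C(i, 2) + e)%N.
  by rewrite /block leq_addr bin2S ltn_add2l ltn_ord.
set t := ('C(i, 2) + e)%N in it.
have := crel t (block_lt it ik kd); rewrite (bigD1 i) //=.
rewrite [X in _ + X]big1; last first.
  move=> l li; rewrite big1 // => l' _.
  by rewrite (flip_horner_eq0 ik it) ?mulr0 ?mul0r.
under eq_bigr => l _ do rewrite -mulrA mulrCA.
rewrite addr0 -mulr_sumr => /eqP; rewrite mulf_eq0 (negPf (flip_horner_neq0 ik it)) /=.
move=> /eqP sum0; rewrite !mxE -[RHS]sum0.
rewrite [RHS](bigID (fun l : 'I_k.+1 => (l < i)%N)) /=.
rewrite [X in _ + X]big1 ?addr0; last first.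
  (* The diagonal term vanishes because w_t is a root of conj p_i, the terms with l > i by
     induction. *)
  move=> l; rewrite -leqNgt => il; have [li|li] := eqVneq l i.
    by rewrite li (flipc_horner_eq0 ik it) mulr0.
  rewrite IHr ?mul0r // 1?eq_sym //.
  have : i != l :> nat by apply: contra_neq li => /val_inj.
  by lia.
rewrite big_ord_narrow ?(ltnW (ltn_ord i)) // => ik'.
apply: eq_bigr => l _; rewrite !mxE; congr (c i _ * _).
  exact: val_inj.
Qed.
(** At the first point of S_i, i > 0, only p_i is nonzero. As S_0 is empty, the coefficient of p_0
    comes last, from p_0 being monic. *)
Lemma flip_poly_free (g : 'I_k.+1 -> C) :
  \sum_i g i *: p i = 0 -> forall i, g i = 0.
Proof.
move=> g0.
have gpos (i : 'I_k.+1) : (0 < i)%N -> g i = 0.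
  move=> i0; have ik : (i <= k)%N by rewrite -ltnS.
  have it := block_first i0.
  have /eqP := congr1 (fun q => q.[w 'C(i, 2)]) g0.
  rewrite horner_sum horner0 (bigD1 i) //= big1 ?addr0 => [|j ji]; last first.
    by rewrite hornerZ (flip_horner_eq0 ik it) ?mulr0.
  rewrite hornerZ mulf_eq0 (negPf (flip_horner_neq0 ik it)) orbF.
  by move/eqP.
move=> i; have [->|i0] := eqVneq i ord0; last by apply: gpos; rewrite lt0n.
move: g0; rewrite (bigD1 ord0) //= big1 ?addr0 => [/eqP|j j0]; last first.
  by rewrite gpos ?scale0r // lt0n.
have p0 : p (@ord0 k) != 0.
  by apply/monic_neq0/monic_prod => t _; apply: monicXsubC.
by rewrite scaler_eq0 (negPf p0) orbF => /eqP.
Qed.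

End ConjugatePairs.

(** * Convex hulls and their extreme points *)

Section ConvexHull.
Variables (R : realFieldType) (E : lmodType R) (n : nat) (v : 'I_n.+1 -> E).

Lemma convex_hull_convex : is_convex (convex_hull v).
Proof.
move=> _ _ t [c [c0 c1 ->]] [e [e0 e1 ->]] /andP[t0 t1].
exists (fun i => t * c i + (1 - t) * e i); split.
- by move=> i; rewrite addr_ge0 // mulr_ge0 // subr_ge0.
- by rewrite big_split /= -!mulr_sumr c1 e1; ring.
- rewrite !scaler_sumr -big_split; apply: eq_bigr => i _.
  by rewrite !scalerA scalerDl.
Qed.

Lemma convex_hull_vertex i : convex_hull v (v i).
Proof.
exists (fun j => (j == i)%:R); split=> [j||]; first exact: ler0n.
  by rewrite (bigD1 i) //= eqxx big1 ?addr0 // => j /negPf ->.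
rewrite (bigD1 i) //= eqxx scale1r big1 ?addr0 // => j /negPf ->.
by rewrite scale0r.
Qed.

(** If some v_i has weight strictly between 0 and 1, the point lies strictly between v_i and the
    renormalized combination of the other vertices, so extremality identifies it with v_i. *)
Lemma extreme_point_convex_hull x :
  extreme_point (convex_hull v) x -> exists i, x = v i.
Proof.
move=> [[c [c0 c1 xE]] xext].
have [i ci] : exists i, c i != 0.
  apply/existsP; apply: contraPT (oner_neq0 R) => /existsPn c_eq0.
  by rewrite -c1 big1 ?eqxx // => i _; apply/eqP; rewrite -[_ == _]negbK c_eq0.
have ci_gt0 : 0 < c i by rewrite lt_def ci c0.
exists i; have cE : \sum_(j | j != i) c j = 1 - c i.
  by rewrite -c1 [in RHS](bigD1 i) //= addrC addrK.
have [ci1|ci1] := eqVneq (c i) 1.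
  rewrite xE (bigD1 i) //= ci1 scale1r big1 ?addr0 // => j ji.
  move/eqP: cE; rewrite ci1 subrr psumr_eq0 // => /allP/(_ j).
  by rewrite mem_index_enum ji => /(_ isT)/eqP->; rewrite scale0r.
have ci_lt1 : 0 < 1 - c i.
  rewrite lt_def subr_eq0 eq_sym ci1 -cE sumr_ge0 //.
pose y := \sum_(j | j != i) (c j / (1 - c i)) *: v j.
have yH : convex_hull v y.
  exists (fun j => if j != i then c j / (1 - c i) else 0); split.
  - by move=> j; case: ifP => // _; rewrite divr_ge0 // ltW.
  - by rewrite -big_mkcond /= -mulr_suml cE divff // gt_eqF.
  - rewrite /y big_mkcond; apply: eq_bigr => j _; case: ifP => // _.
    by rewrite scale0r.
have [||<- //] := xext (v i) y (c i) (convex_hull_vertex i) yH.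
  by rewrite ci_gt0 -subr_gt0.
rewrite xE (bigD1 i) //=; congr (_ + _).
rewrite scaler_sumr; apply: eq_bigr => j _.
by rewrite scalerA mulrCA divff ?mulr1 // gt_eqF.
Qed.

Lemma has_dim_convex_hull : affinely_independent v -> has_dim (convex_hull v) n.
Proof.
move=> vI; exists v; split=> // [i|x [c [_ c1 ->]]]; first exact: convex_hull_vertex.
by exists c.
Qed.

End ConvexHull.

(** * Free families and coefficient vectors of forms *)

Section Free.
Variables (K : fieldType) (V : vectType K).

Lemma free_scale_subfamily n (p : 'I_n -> V) (a : 'I_n -> K) :
  free [seq p i | i <- enum 'I_n] ->
  free [seq a i *: p i | i <- enum 'I_n & a i != 0].
Proof.
move=> p_free.
(* The whole family stays free once rescaled by nonzero factors; the vectors with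
   a i != 0 then form a part of it. *)
pose b i := if a i == 0 then 1 else a i.
have b0 i : b i != 0 by rewrite /b; case: ifP => [|/negbT//]; rewrite oner_eq0.
have bp_free : free [seq b i *: p i | i <- enum 'I_n].
  have -> : [seq b i *: p i | i <- enum 'I_n] = [tuple b i *: p i | i < n] by [].
  apply/freeP => g g0 i; have := @freeP _ _ _ [tuple p i | i < n] p_free.
  move=> /(_ (fun i => g i * b i)) H.
  suff /(_ i)/eqP : forall i, g i * b i = 0.
    by rewrite mulf_eq0 (negPf (b0 i)) orbF => /eqP.
  apply: H; rewrite -[RHS]g0; apply: eq_bigr => j _.
  by rewrite -!tnth_nth !tnth_mktuple scalerA.
have -> : [seq a i *: p i | i <- enum 'I_n & a i != 0] =
    [seq b i *: p i | i <- enum 'I_n & a i != 0].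
  by apply/eq_in_map => i; rewrite mem_filter /b => /andP[/negPf ->].
apply: (catl_free (Y := [seq b i *: p i | i <- enum 'I_n & ~~ (a i != 0)])).
rewrite -map_cat (perm_free (Y := [seq b i *: p i | i <- enum 'I_n])) //.
by apply: perm_map; rewrite perm_filterC.
Qed.

End Free.

Section CoefVector.
Variables (K : fieldType) (m : nat).

Definition coef_row (p : binform K m) : 'rV[K]_m.+1 :=
  \row_i (p : {mpoly K[2]})@_(binmon m i).

Fact coef_row_is_linear : linear coef_row.
Proof. by move=> a p q; apply/rowP => i; rewrite !mxE /= mcoeffD mcoeffZ. Qed.

HB.instance Definition _ :=
  GRing.isLinear.Build K (binform K m) 'rV[K]_m.+1 _ coef_row coef_row_is_linear.

Lemma coef_row_inj : injective coef_row.
Proof.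
move=> p q pq; apply: val_inj; rewrite /= (binformE p) (binformE q).
apply: eq_bigr => i _; congr (_ *: _).
by have := congr1 (fun u : 'rV_m.+1 => u 0 i) pq; rewrite !mxE.
Qed.

End CoefVector.

(** * Hermitian tensors tested against linear functionals *)

Section Tensor.
Variables (R : realType) (d : nat).
Local Notation C := R[i].
Implicit Types (p q : binform C d) (x : 'cV[C]_d.+1).

Local Notation conj_mx := (map_mx (@Num.conj C)).

Lemma tensE p q : tens p q = (coef_row p)^T *m conj_mx (coef_row q).
Proof. by apply/matrixP => i j; rewrite !mxE big_ord1 !mxE. Qed.

Lemma tens_sum n (a : 'I_n -> C) (p : 'I_n -> binform C d) :
  tens (\sum_i a i *: p i) (\sum_j a j *: p j) =
  \sum_i \sum_j (a i * (a j)^*) *: tens (p i) (p j).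
Proof.
rewrite tensE !linear_sum /= mulmx_suml; apply: eq_bigr => i _.
rewrite map_mx_sum mulmx_sumr; apply: eq_bigr => j _.
by rewrite !linearZ /= map_mxZ -scalemxAl -scalemxAr scalerA tensE.
Qed.

(** The linear functional with coordinates x. Images of tensors are located through the functionals
    that kill them, which avoids comparing different decompositions. *)
Definition pairing x p : C := (coef_row p *m x) 0 0.

Lemma pairing_col n (A : 'M[C]_(d.+1, n)) j p :
  pairing (col j A) p = (coef_row p *m A) 0 j.
Proof. by rewrite /pairing colE mulmxA -colE mxE. Qed.

Lemma pairing_tens_l x p q : x^T *m tens p q = pairing x p *: conj_mx (coef_row q).
Proof.
rewrite tensE mulmxA -trmx_mul; have -> : (coef_row p *m x)^T = (pairing x p)%:M.
  by apply/matrixP => i j; rewrite !ord1 [LHS]mxE [RHS]mxE eqxx mulr1n.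
by rewrite mul_scalar_mx.
Qed.

Lemma pairing_tens_r x p q :
  tens p q *m conj_mx x = (pairing x q)^* *: (coef_row p)^T.
Proof.
rewrite tensE -mulmxA -map_mxM.
have -> : conj_mx (coef_row q *m x) = ((pairing x q)^*)%:M.
  by apply/matrixP => i j; rewrite !ord1 [LHS]mxE [RHS]mxE eqxx mulr1n.
by rewrite mul_mx_scalar.
Qed.

(** The Hermitian form attached to the tensor A, evaluated at the functional x. *)
Definition quad x (A : 'M[C]_d.+1) : C := (x^T *m A *m conj_mx x) 0 0.

Fact quad_is_linear x : scalar (quad x).
Proof.
by move=> a A B; rewrite /quad mulmxDr mulmxDl -scalemxAr -scalemxAl !mxE.
Qed.

HB.instance Definition _ x :=
  GRing.isLinear.Build C 'M[C]_d.+1 C _ (quad x) (quad_is_linear x).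

Lemma quad_tens x p : quad x (tens p p) = pairing x p * (pairing x p)^*.
Proof.
rewrite /quad pairing_tens_l -scalemxAl mxE -map_mxM mxE.
by rewrite /pairing.
Qed.

Lemma quad_psd_ge0 x (theta : herm_tensor R d) : psd theta -> 0 <= quad x theta.
Proof.
move=> [s [[_ ->] /allP s_pos]]; rewrite linear_sum big_seq sumr_ge0 // => u us.
by rewrite (negPf (s_pos u us)) expr0 scale1r /= quad_tens mul_conjC_ge0.
Qed.

Lemma quad_psd_eq0 x (theta : herm_tensor R d) s :
    herm_decomp theta s -> all (fun u => ~~ u.1) s -> quad x theta = 0 ->
  forall u, u \in s -> pairing x u.2 = 0.
Proof.
move=> [_ ->] /allP s_pos; rewrite linear_sum big_seq => /eqP.
rewrite psumr_eq0 => [|u us]; last first.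
  by rewrite (negPf (s_pos u us)) expr0 scale1r /= quad_tens mul_conjC_ge0.
move=> /allP q0 u us; have := q0 u us; rewrite us implyTb.
by rewrite (negPf (s_pos u us)) expr0 scale1r /= quad_tens mul_conjC_eq0 => /eqP.
Qed.

(** The product is the sum of the eps_j conj(x(p_j)) p_j, so freeness of the p_j kills every
    coefficient. The signs are arbitrary, as [tens_im] refers to any decomposition. *)
Lemma pairing_decomp_eq0 x (theta : herm_tensor R d) s :
    herm_decomp theta s -> (theta : 'M[C]_d.+1) *m conj_mx x = 0 ->
  forall u, u \in s -> pairing x u.2 = 0.
Proof.
move=> [s_free ->]; rewrite mulmx_suml => sum0.
pose X := map_tuple snd (in_tuple s).
have := @freeP _ _ _ X s_free => Xfree.
pose u0 : bool * binform C d := (false, 0).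
pose g (i : 'I_(size s)) : C :=
  (-1) ^+ (nth u0 s i).1 * (pairing x (nth u0 s i).2)^*.
have g0 : forall i, g i = 0.
  apply: Xfree; apply: coef_row_inj; rewrite linear0 linear_sum.
  apply: trmx_inj; rewrite trmx0 -[RHS]sum0 linear_sum (big_nth u0) big_mkord.
  apply: eq_bigr => i _.
  rewrite -scalemxAl pairing_tens_r scalerA linearZ /= linearZ /=.
  by rewrite (nth_map u0).
move=> u us; have ui : (index u s < size s)%N by rewrite index_mem.
have /eqP := g0 (Ordinal ui); rewrite /g /= nth_index // mulf_eq0 signr_eq0 /=.
by rewrite conjC_eq0 => /eqP.
Qed.

Fact tens_herm p : tens p p \is hermsymmx.
Proof.
apply/is_hermitianmxP; rewrite expr0 scale1r; apply/matrixP => i j.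
by rewrite !mxE rmorphM /= conjCK mulrC.
Qed.

Definition rank_one p : herm_tensor R d := HermTensor (tens_herm p).

Fact tens_mul_is_linear : linear (@tens_mul R d).
Proof.
move=> a A B; rewrite /tens_mul scaler_sumr -big_split; apply: eq_bigr => i _ /=.
rewrite scaler_sumr -big_split; apply: eq_bigr => j _ /=.
by rewrite !mxE scalerDl scalerA.
Qed.

HB.instance Definition _ :=
  GRing.isLinear.Build C 'M[C]_d.+1 {mpoly C[2]} _ (@tens_mul R d)
    tens_mul_is_linear.

Fact herm_mx_is_zmod_morphism : zmod_morphism (@herm_mx R d).
Proof. by []. Qed.

HB.instance Definition _ :=
  GRing.isZmodMorphism.Build (herm_tensor R d) 'M[C]_d.+1 (@herm_mx R d)
    herm_mx_is_zmod_morphism.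

Lemma herm_mxZ (a : R) (theta : herm_tensor R d) :
  herm_mx (a *: theta) = (a%:C)%C *: herm_mx theta.
Proof. by []. Qed.

Lemma quad_comb x (t u : R) (theta eta : herm_tensor R d) :
  quad x (herm_mx (t *: theta + u *: eta)) =
  (t%:C)%C * quad x theta + (u%:C)%C * quad x eta.
Proof.
have -> : herm_mx (t *: theta + u *: eta) =
    (t%:C)%C *: herm_mx theta + (u%:C)%C *: herm_mx eta by [].
by rewrite linearD !linearZ.
Qed.

Lemma herm_decomp_rank_one p : p != 0 -> herm_decomp (rank_one p) [:: (false, p)].
Proof.
move=> p0; split; first by rewrite /= free_cons span_nil memv0 p0 nil_free.
by rewrite big_seq1 expr0 scale1r.
Qed.

End Tensor.

(** * The face spanned by rank one tensors *)

Section RankOneFace.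
Variables (R : realType) (d k : nat) (f : binform R (2 * d)).
Local Notation C := R[i].
Local Notation conj_mx := (map_mx (@Num.conj C)).
Local Notation fC := (map_mpoly (real_complex R) (f : {mpoly R[2]})).

Variable p : 'I_k.+1 -> binform C d.
Hypothesis f_neq0 : fC != 0.
Hypothesis p_free : free [seq p i | i <- enum 'I_k.+1].
Hypothesis p_gram : forall i, tens_mul (tens (p i) (p i)) = fC.
Hypothesis p_rel : forall c : 'M[C]_k.+1,
  (forall i j, c j i = (c i j)^*) ->
  tens_mul (\sum_i \sum_j c i j *: tens (p i) (p j)) = fC ->
  forall i j, i != j -> c i j = 0.

Let v i : herm_tensor R d := rank_one (p i).
Let pU := <<[seq p i | i <- enum 'I_k.+1]>>%VS.

Lemma sum_rank_oneE (c : 'I_k.+1 -> R) :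
  herm_mx (\sum_i c i *: v i) = \sum_i (c i)%:C%C *: tens (p i) (p i).
Proof. by rewrite raddf_sum; apply: eq_bigr => i _; apply: herm_mxZ. Qed.

Let P := \matrix_i coef_row (p i).

Lemma p_family_eq0 (g : 'I_k.+1 -> C) :
  \sum_i g i *: p i = 0 -> forall i, g i = 0.
Proof.
move=> g0; apply: (@freeP _ _ _ [tuple p i | i < k.+1] p_free).
by rewrite -[RHS]g0; apply: eq_bigr => i _; rewrite -tnth_nth tnth_mktuple.
Qed.

Lemma p_neq0 i : p i != 0.
Proof.
by apply: (free_not0 p_free); rewrite map_f // mem_enum.
Qed.

Lemma mem_pUP u :
  reflect (exists a : 'I_k.+1 -> C, u = \sum_i a i *: p i) (u \in pU).
Proof.
apply: (iffP idP) => [upU|[a ->]].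
  exists (fun i => coord [tuple p i | i < k.+1] i u).
  rewrite {1}(@coord_span _ _ _ [tuple p i | i < k.+1] u) //.
  by apply: eq_bigr => i _; rewrite -tnth_nth tnth_mktuple.
by apply: memv_suml => i _; rewrite memvZ // memv_span // map_f // mem_enum.
Qed.

(** Double annihilator: the columns of the cokernel of P are functionals that cut out the row space
    of P. *)
Lemma mem_pU_annihilator u :
  (forall x, (forall i, pairing x (p i) = 0) -> pairing x u = 0) -> u \in pU.
Proof.
move=> ann.
have : (coef_row u <= P)%MS.
  rewrite submxE; apply/eqP/rowP => j; rewrite [RHS]mxE.
  rewrite -pairing_col ann // => i; rewrite pairing_col.
  rewrite -[coef_row (p i)](rowK (fun i => coef_row (p i))).
  by rewrite -row_mul mulmx_coker !mxE.
move=> /submxP[D uE]; apply/mem_pUP; exists (fun i => D 0 i).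
apply: coef_row_inj; rewrite uE mulmx_sum_row linear_sum.
by apply: eq_bigr => i _; rewrite rowK linearZ.
Qed.

Lemma psd_convex_hull (c : 'I_k.+1 -> R) :
  (forall i, 0 <= c i) -> psd (\sum_i c i *: v i).
Proof.
move=> c0; pose a i := (Num.sqrt (c i))%:C%C.
(* The weights are absorbed as square roots; vectors of weight zero are dropped, since a
   decomposition must be free. *)
pose s := [seq (false, a i *: p i) | i <- enum 'I_k.+1 & a i != 0].
have s_pos : all (fun u => ~~ u.1) s by apply/allP => _ /mapP[i _ ->].
exists s; split=> //; split.
  by rewrite /unzip2 -map_comp; apply: free_scale_subfamily.
rewrite sum_rank_oneE big_map big_filter big_enum_cond /= [RHS]big_mkcond.
apply: eq_bigr => i _; rewrite expr0 scale1r.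
have -> : tens (a i *: p i) (a i *: p i) = (c i)%:C%C *: tens (p i) (p i).
  rewrite !tensE !linearZ /= map_mxZ -scalemxAl -scalemxAr scalerA.
  rewrite [X in a i * X](_ : _ = a i); last exact: conjc_real.
  by rewrite -rmorphM -expr2 sqr_sqrtr.
case: eqP => // /eqP; rewrite fmorph_eq0 sqrtr_eq0 => ci.
by rewrite (le_anti (introT andP (conj ci (c0 i)))) rmorph0 scale0r.
Qed.

Lemma tens_mul_convex_hull (c : 'I_k.+1 -> C) :
  tens_mul (\sum_i c i *: tens (p i) (p i)) = (\sum_i c i) *: fC.
Proof.
rewrite linear_sum scaler_suml; apply: eq_bigr => i _.
by rewrite linearZ /= p_gram.
Qed.

Lemma convex_hull_gram : convex_hull v `<=` gram_spectrahedron f.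
Proof.
move=> _ [c [c0 c1 ->]]; split; first exact: psd_convex_hull.
by rewrite sum_rank_oneE tens_mul_convex_hull -rmorph_sum c1 rmorph1 scale1r.
Qed.

Lemma convex_hull_annihilator x theta :
    (forall i, pairing x (p i) = 0) -> convex_hull v theta ->
  (theta : 'M[C]_d.+1) *m conj_mx x = 0.
Proof.
move=> x0 [c [_ _ ->]]; rewrite sum_rank_oneE mulmx_suml big1 // => i _.
by rewrite -scalemxAl pairing_tens_r x0 conjC0 scale0r scaler0.
Qed.

(** Vanishing on the annihilator of the p_i puts the image of theta into their span, so theta is a
    Hermitian combination of the tensors of p_i and conj p_j, which [p_rel] makes diagonal. *)
Lemma gram_sub_convex_hull theta :
    gram_spectrahedron f theta ->
    (forall x, (forall i, pairing x (p i) = 0) -> quad x theta = 0) ->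
  convex_hull v theta.
Proof.
move=> [[s [s_dec s_pos]] theta_f] ann.
have s_pU u : u \in s -> exists a : 'I_k.+1 -> C, u.2 = \sum_i a i *: p i.
  move=> us; apply/mem_pUP/mem_pU_annihilator => x /ann qx.
  exact: quad_psd_eq0 s_dec s_pos qx u us.
have [c [cH c0 thetaE]] : exists c : 'M[C]_k.+1,
    [/\ forall i j, c j i = (c i j)^*, forall i, 0 <= c i i
      & herm_mx theta = \sum_i \sum_j c i j *: tens (p i) (p j)].
  (* A summand given by the vector \sum_i a_i p_i adds the matrix of the a_i conj a_j to c. *)
  have [_ ->] := s_dec; elim: s s_pos s_pU {s_dec} => [|u s IHs] /=.
    move=> _ _; exists 0; split=> [i j|i|]; rewrite ?mxE ?conjC0 //.
    rewrite big_nil big1 // => i _; rewrite big1 // => j _.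
    by rewrite mxE scale0r.
  move=> /andP[u_pos s_pos] s_pU.
  have [|c [cH c0 sE]] := IHs s_pos.
    by move=> w ws; apply: s_pU; rewrite inE ws orbT.
  have [a uE] := s_pU u (mem_head _ _).
  exists (\matrix_(i, j) (a i * (a j)^* + c i j)); split.
  - by move=> i j; rewrite !mxE rmorphD rmorphM /= conjCK cH mulrC.
  - by move=> i; rewrite mxE addr_ge0 // mul_conjC_ge0.
  rewrite big_cons sE (negPf u_pos) expr0 scale1r uE tens_sum -big_split.
  apply: eq_bigr => i _; rewrite -big_split; apply: eq_bigr => j _.
  by rewrite mxE scalerDl.
have theta_f' := theta_f; rewrite thetaE in theta_f'.
have {theta_f'} cD := p_rel cH theta_f'.
have {}thetaE : herm_mx theta = \sum_i c i i *: tens (p i) (p i).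
  rewrite thetaE; apply: eq_bigr => i _; rewrite (bigD1 i) //= big1 ?addr0 //.
  by move=> j ji; rewrite cD 1?eq_sym // scale0r.
have cR i : ((complex.Re (c i i))%:C)%C = c i i by rewrite RRe_real // ger0_real.
exists (fun i => complex.Re (c i i)); split.
- by move=> i; rewrite -ler0c cR.
(* Applying [tens_mul] shows that f is the sum of the weights times f, and f is nonzero. *)
- apply: (fmorph_inj (real_complex R)); rewrite rmorph1 rmorph_sum /=.
  under eq_bigr => i _ do rewrite cR.
  apply/eqP; rewrite -subr_eq0; have := f_neq0; apply: contraNT => c1.
  have := tens_mul_convex_hull (fun i => c i i); rewrite -thetaE theta_f.
  move=> /eqP; rewrite eq_sym -subr_eq0 -{2}[fC]scale1r -scalerBl scaler_eq0.
  by rewrite (negPf c1).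
- apply: val_inj; rewrite /= thetaE sum_rank_oneE.
  by apply: eq_bigr => i _; rewrite cR.
Qed.

(** On the annihilator of the p_i the Hermitian forms of both endpoints are nonnegative with
    vanishing weighted sum, so each vanishes and [gram_sub_convex_hull] applies. *)
Lemma convex_hull_face : is_face (gram_spectrahedron f) (convex_hull v).
Proof.
split; [exact: convex_hull_gram | exact: convex_hull_convex |].
have half (t : R) theta1 theta2 : 0 < t < 1 ->
    gram_spectrahedron f theta1 -> gram_spectrahedron f theta2 ->
    convex_hull v (t *: theta1 + (1 - t) *: theta2) -> convex_hull v theta1.
  move=> /andP[t0 t1] th1 th2 hull; apply: gram_sub_convex_hull => // x x0.
  have := convex_hull_annihilator x0 hull.
  move=> /(congr1 (fun y => (x^T *m y) 0 0)).
  rewrite mulmxA mulmx0 [RHS]mxE -/(quad x _) quad_comb.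
  have q1 := quad_psd_ge0 x th1.1; have q2 := quad_psd_ge0 x th2.1.
  have t0' : 0 < (t%:C)%C :> C by rewrite ltcR.
  have t1' : 0 <= ((1 - t)%:C)%C :> C by rewrite ler0c subr_ge0 ltW.
  move=> /eqP; rewrite paddr_eq0 ?mulr_ge0 // 1?ltW // => /andP[/eqP + _].
  by move=> /eqP; rewrite mulf_eq0 gt_eqF //= => /eqP.
move=> theta1 theta2 t th1 th2 t01 hull; split; first exact: half t01 th1 th2 hull.
apply: (half (1 - t) theta2 theta1) => //.
  by rewrite subr_gt0 ltrBlDr ltrDl andbC.
by rewrite subKr addrC.
Qed.

(** For a functional x dual to p_i, [quad x] reads off the weight c_i; column i of a right inverse
    of P is such an x. *)
Lemma rank_one_affinely_independent : affinely_independent v.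
Proof.
move=> c _ c0 i; have [x xi xj] : exists2 x, pairing x (p i) != 0 &
    forall j, j != i -> pairing x (p j) = 0.
  have P_free : row_free P.
    apply: inj_row_free => g g0; apply/rowP => j; rewrite mxE.
    apply: (p_family_eq0 (g := fun j => g 0 j)); apply: coef_row_inj.
    rewrite linear0 -[RHS]g0 mulmx_sum_row linear_sum.
    by apply: eq_bigr => l _; rewrite rowK linearZ.
  have xE j : pairing (col i (pinvmx P)) (p j) = (j == i)%:R.
    rewrite pairing_col -[coef_row (p j)](rowK (fun i => coef_row (p i))).
    by rewrite -row_mul mulmxVp // !mxE.
  exists (col i (pinvmx P)); first by rewrite xE eqxx oner_neq0.
  by move=> j /negPf ji; rewrite xE ji.
have := congr1 (fun theta : herm_tensor R d => quad x theta) c0.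
rewrite sum_rank_oneE linear_sum (bigD1 i) //= linearZ /= quad_tens.
rewrite big1 ?addr0 => [|j ji]; last first.
  by rewrite linearZ /= quad_tens xj // mul0r mulr0.
rewrite !raddf0 => /eqP; rewrite mulf_eq0 mul_conjC_eq0 (negPf xi) orbF.
by rewrite fmorph_eq0 => /eqP.
Qed.

(** The vertices already yield the whole span of the p_i. Conversely, a functional vanishing on the
    p_i kills every tensor of the hull, hence its image. *)
Lemma convex_hull_face_rank : has_face_rank (convex_hull v) k.+1.
Proof.
exists pU; split; last first.
  by have /eqP := p_free; rewrite size_map size_enum_ord.
apply/seteqP; split=> u /=.
  move=> /mem_pUP[a ->]; exists k.+1, v, (fun i => a i *: p i); split=> // i.
    exact: convex_hull_vertex.
  exists [:: (false, p i)]; split; first exact: herm_decomp_rank_one (p_neq0 i).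
  by rewrite /= span_seq1 memvZ // memv_line.
move=> [n [theta [w [thetaF wim ->]]]]; apply: memv_suml => i _.
have [s [s_dec]] := wim i; apply/subvP/span_subvP => _ /mapP[u' us ->].
apply: mem_pU_annihilator => x x0.
exact: pairing_decomp_eq0 s_dec (convex_hull_annihilator x0 (thetaF i)) _ us.
Qed.

Lemma rank_one_face :
  [/\ is_face (gram_spectrahedron f) (convex_hull v),
      is_simplex (convex_hull v),
      has_face_rank (convex_hull v) k.+1,
      has_dim (convex_hull v) k
    & forall theta, extreme_point (convex_hull v) theta -> has_rank theta 1].
Proof.
have v_indep := rank_one_affinely_independent; split.
- exact: convex_hull_face.
- by exists k, v.
- exact: convex_hull_face_rank.
- exact: has_dim_convex_hull.
move=> theta /extreme_point_convex_hull[i ->]; exists [:: (false, p i)].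
by split=> //; apply: herm_decomp_rank_one; apply: p_neq0.
Qed.

End RankOneFace.

(** * Binary forms as univariate polynomials *)

Section Dehomogenization.
Variable K : fieldType.

(** The substitution y = 1, taken on all polynomials so as to be a ring morphism; injectivity holds
    once the degree is fixed. *)
Definition dehom : {mpoly K[2]} -> {poly K} :=
  mmap polyC (fun i : 'I_2 => if i == ord0 then 'X else 1).

HB.instance Definition _ := GRing.RMorphism.copy dehom
  (mmap polyC (fun i : 'I_2 => if i == ord0 then 'X else 1)).

Lemma dehomZ a q : dehom (a *: q) = a *: dehom q.
Proof. by rewrite /dehom mmapZ mul_polyC. Qed.

Lemma dehomM p q : dehom (p * q) = dehom p * dehom q.
Proof. exact: rmorphM. Qed.

Lemma dehomX m i : dehom 'X_[binmon m i] = 'X^i.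
Proof.
by rewrite /dehom mmapX /mmap1 big_ord_recl big_ord1 !mnmE /= expr1n mulr1.
Qed.

Lemma dehomE m (q : binform K m) :
  dehom q = \sum_(i < m.+1) (q : {mpoly K[2]})@_(binmon m i) *: 'X^i.
Proof.
rewrite {1}(binformE q) raddf_sum; apply: eq_bigr => i _ /=.
by rewrite dehomZ dehomX.
Qed.

Lemma dehom_lincomb n m (g : 'I_n -> K) (q : 'I_n -> binform K m) :
  dehom (\sum_i g i *: q i : binform K m) = \sum_i g i *: dehom (q i).
Proof.
rewrite [X in dehom X]raddf_sum raddf_sum.
by apply: eq_bigr => i _; rewrite /= dehomZ.
Qed.

Lemma dehom_inj m : {in m.-homog &, injective dehom}.
Proof.
move=> q q' qh qh' e; suff : DHomog qh = DHomog qh' by move/(congr1 val).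
apply: coef_row_inj; apply/rowP => i; rewrite !mxE /=.
have := congr1 (fun r : {poly K} => r`_i) e.
rewrite (dehomE (DHomog qh)) (dehomE (DHomog qh')).
rewrite -(poly_def m.+1 (fun i => q@_(binmon m i))).
rewrite -(poly_def m.+1 (fun i => q'@_(binmon m i))).
by rewrite !coef_poly ltn_ord.
Qed.

Definition rehom m (q : {poly K}) : {mpoly K[2]} :=
  \sum_(i < m.+1) q`_i *: 'X_[binmon m i].

Lemma rehom_homog m q : rehom m q \is m.-homog.
Proof.
apply: rpred_sum => i _; apply: rpredZ; rewrite dhomogX.
rewrite /= mdegE big_ord_recl big_ord1 !mnmE /= subnKC //.
by rewrite -ltnS ltn_ord.
Qed.

Lemma rehomK m (q : {poly K}) : (size q <= m.+1)%N -> dehom (rehom m q) = q.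
Proof.
move=> sq; rewrite raddf_sum /=.
under eq_bigr => i _ do rewrite dehomZ dehomX.
rewrite -(poly_def m.+1 (nth 0 q)); apply/polyP => i; rewrite coef_poly.
by case: ltnP => // mi; rewrite nth_default // (leq_trans sq).
Qed.

End Dehomogenization.

Lemma map_mpoly_homog (K L : fieldType) (g : {rmorphism K -> L}) m
    (q : {mpoly K[2]}) :
  q \is m.-homog -> map_mpoly g q \is m.-homog.
Proof.
move=> /dhomogP qh; apply/dhomogP => e; rewrite mcoeff_msupp mcoeff_map_mpoly => ge.
apply: qh; rewrite mcoeff_msupp; apply: contra_neq ge => ->.
exact: rmorph0.
Qed.

Lemma dehom_map (K L : fieldType) (g : {rmorphism K -> L}) m (q : binform K m) :
  dehom (map_mpoly g q) = map_poly g (dehom q).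
Proof.
have gh := map_mpoly_homog g (dhomog_is_dhomog q).
rewrite (dehomE (DHomog gh)) dehomE rmorph_sum; apply: eq_bigr => i _ /=.
by rewrite map_polyZ map_polyXn mcoeff_map_mpoly.
Qed.

(** * The genericity condition on the 2d roots *)

Section Configuration.
Variables (R : numFieldType) (d k : nat).
Hypothesis kd : ('C(k.+1, 2) <= d)%N.

(** Root sequences are indexed by [nat], hence a default value; the indices occurring in
    [configuration] stay in range. *)
Definition nat_var n t : {mpoly R[n]} := if insub t is Some i then 'X_i else 0.

Lemma mmap_nat_var (S : comNzRingType) (f : {rmorphism R -> S}) n (z : nat -> S) t :
  (t < n)%N -> mmap f (fun i : 'I_n => z i) (nat_var n t) = z t.
Proof. by move=> tn; rewrite /nat_var insubT mmapX mmap1U. Qed.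

(** Variable t < d stands for w_t and variable d + t for its conjugate. The first product expresses
    distinctness of the roots, the second invertibility of the block matrices. *)
Definition configuration : {mpoly R[2 * d]} :=
  (\prod_(i < 2 * d) \prod_(j < 2 * d | j != i) ('X_i - 'X_j)) *
  \prod_(m < k.+1) \det (block_eval_mx d (nat_var _) (fun t => nat_var _ (d + t)) m).

Lemma mmap_det_block_eval_mx (S : comNzRingType) (f : {rmorphism R -> S})
    (z : nat -> S) m : (m <= k)%N ->
  mmap f (fun i : 'I_(2 * d) => z i)
    (\det (block_eval_mx d (nat_var _) (fun t => nat_var _ (d + t)) m)) =
  \det (block_eval_mx d z (fun t => z (d + t)%N) m).
Proof.
move=> mk; rewrite (det_block_eval_mx_map (mmap f (fun i : 'I_(2 * d) => z i))).
congr (\det _); apply: eq_block_eval_mx => [|t td|t td] /=.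
- by apply: leq_trans kd; apply: leq_bin2l.
- by apply: mmap_nat_var; lia.
- by apply: mmap_nat_var; lia.
Qed.

Lemma configuration_neq0 : configuration != 0.
Proof.
rewrite mulf_neq0 //; last first.
  apply/prodf_neq0 => m _; have mk : (m <= k)%N by rewrite -ltnS.
  have md : ('C(m.+1, 2) <= d)%N by apply: leq_trans kd; apply: leq_bin2l.
  have [a [b ab]] := @det_block_eval_mx_neq0 R d m md.
  apply: contra_neq ab => m0.
  (* The two witness sequences, laid out one after the other. *)
  pose z t := if (t < d)%N then a t else b (t - d)%N.
  have := @mmap_det_block_eval_mx R idfun z m mk; rewrite m0 mmap0 => ->.
  congr (\det _); apply: eq_block_eval_mx => // t td; rewrite /z ?td //.
  by rewrite ltnNge leq_addr /= addKn.
apply/prodf_neq0 => i _; apply/prodf_neq0 => j ji; rewrite subr_eq0.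
apply: contra_neq ji => /(congr1 (mcoeff U_(j)%MM)); rewrite !mcoeffX eqxx.
case: eqP => [/mnmP/(_ j)|_ /esym/eqP]; last by rewrite oner_eq0.
by rewrite !mnm1E eqxx; case: eqP.
Qed.

Lemma mmap_configuration (S : idomainType) (f : {rmorphism R -> S}) (z : nat -> S) :
  mmap f (fun i : 'I_(2 * d) => z i) configuration != 0 ->
  (forall s t, (s < 2 * d)%N -> (t < 2 * d)%N -> s != t -> z s != z t) /\
  (forall m, (m <= k)%N -> \det (block_eval_mx d z (fun t => z (d + t)%N) m) != 0).
Proof.
rewrite rmorphM mulf_eq0 negb_or => /andP[z_inj z_det]; split.
  move=> s t sd td st; apply: contra_neq z_inj => zst.
  rewrite rmorph_prod (bigD1 (Ordinal sd)) //= rmorph_prod.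
  rewrite (bigD1 (Ordinal td)) //=; last by rewrite -val_eqE eq_sym.
  by rewrite rmorphB /= !mmapX !mmap1U /= zst subrr !mul0r.
move=> m mk; rewrite -(mmap_det_block_eval_mx f) //; apply: contra_neq z_det => m0.
by rewrite rmorph_prod (bigD1 (inord m)) //= inordK // m0 mul0r.
Qed.

End Configuration.

(** * The forms p_m attached to a nonnegative form *)

Section NonnegForm.
Variables (R : realType) (d k : nat) (f : binform R (2 * d)).
Local Notation C := R[i].
Local Notation fC := (map_mpoly (real_complex R) (f : {mpoly R[2]})).
Local Notation coef i := ((f : {mpoly R[2]})@_(binmon (2 * d) i)).
Local Notation F := (dehom (f : {mpoly R[2]})).

Lemma eval_dehom (K : fieldType) (q : {mpoly K[2]}) x :
  (dehom q).[x] = q.@[fun i => if i == ord0 then x else 1].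
Proof.
rewrite /dehom mevalE /mmap horner_sum; apply: eq_bigr => m _.
rewrite hornerM hornerC horner_prod; congr (_ * _); apply: eq_bigr => i _.
by rewrite horner_exp; case: ifP; rewrite ?hornerX ?hornerC.
Qed.

Lemma coef_dehom i : (i <= 2 * d)%N -> F`_i = coef i.
Proof.
move=> id; rewrite dehomE -(poly_def _ (fun i => coef i)) coef_poly.
by rewrite ltnS id.
Qed.

Lemma size_dehom : coef (2 * d) != 0 -> size F = (2 * d).+1.
Proof.
move=> c0; rewrite dehomE -(poly_def _ (fun i => coef i)).
by rewrite size_poly_eq.
Qed.

(** The leading coefficient is the value at (1, 0). *)
Lemma nonneg_form_lead : nonneg_form f -> 0 <= coef (2 * d).
Proof.
move=> /(_ (fun i => if i == ord0 then 1 else 0)).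
suff -> : (f : {mpoly R[2]}).@[fun i => if i == ord0 then 1 else 0] =
  coef (2 * d) by [].
have monE i : ('X_[binmon (2 * d) i] : {mpoly R[2]}).@[
    fun i => if i == ord0 then 1 else 0] = (2 * d - i == 0)%N%:R.
  by rewrite mevalX big_ord_recl big_ord1 !mnmE /= expr1n mul1r expr0n.
rewrite [in LHS](binformE f) raddf_sum big_ord_recr /= big1 => [|i _].
  by rewrite mevalZ monE subnn mulr1 add0r.
by rewrite mevalZ monE subn_eq0 leqNgt ltn_ord mulr0.
Qed.

Section Roots.
Local Notation dehomC := (@dehom C).
Variable w : nat -> C.
Hypothesis kd : ('C(k.+1, 2) <= d)%N.
Hypothesis lead_gt0 : 0 < coef (2 * d).
Hypothesis F_roots : map_poly (real_complex R) F =
  (coef (2 * d))%:C%C *: \prod_(0 <= t < d) (('X - (w t)%:P) * ('X - ((w t)^*)%:P)).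
Hypothesis w_inj : forall s t, (s < d)%N -> (t < d)%N -> s != t -> w s != w t.
Hypothesis w_conj : forall s t, (s < d)%N -> (t < d)%N -> w s != (w t)^*.
Hypothesis w_block : forall m, (m <= k)%N ->
  \det (block_eval_mx d w (Num.conj \o w) m) != 0.

Let wc : nat -> C := Num.conj \o w.
(** Scaling by this real number gives p_m conj p_m the leading coefficient of f. *)
Let a : C := (Num.sqrt (coef (2 * d)))%:C%C.

Let a_conj : a^* = a.
Proof. exact: conjc_real. Qed.

Let a_sqr : a * a = (coef (2 * d))%:C%C.
Proof. by rewrite -rmorphM -expr2 sqr_sqrtr // ltW. Qed.

Let a_neq0 : a != 0.
Proof. by rewrite fmorph_eq0 sqrtr_eq0 -ltNge. Qed.

Definition flip_form (m : nat) : binform C d :=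
  DHomog (rehom_homog d (a *: flip_poly d w wc m)).

Lemma dehom_flip_form m : dehomC (flip_form m) = a *: flip_poly d w wc m.
Proof.
rewrite rehomK // (leq_trans (size_scale_leq _ _)) //.
by rewrite size_prod_XsubC size_iota subn0.
Qed.

Lemma dehom_flip_form_conj m :
  dehomC (map_mpoly Num.conj (flip_form m : {mpoly C[2]})) = a *: flip_poly d wc w m.
Proof.
rewrite dehom_map dehom_flip_form map_polyZ /= map_flip_poly a_conj.
by congr (_ *: _); apply: eq_flip_poly => t _ //=; rewrite conjCK.
Qed.

Lemma dehom_map_form : dehomC fC = map_poly (real_complex R) F.
Proof. exact: dehom_map. Qed.

Lemma dehom_root t : (t < d)%N -> (dehomC fC).[w t] = 0.
Proof.
move=> td; rewrite dehom_map_form F_roots hornerZ horner_prod.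
rewrite (bigD1_seq t) ?mem_index_iota ?iota_uniq //=.
by rewrite hornerM hornerXsubC subrr !mul0r mulr0.
Qed.

(** Conjugating w_t only exchanges the two factors of the t-th conjugate pair. *)
Lemma flip_form_gram m : tens_mul (tens (flip_form m) (flip_form m)) = fC.
Proof.
rewrite tens_mul_tens; apply: (@dehom_inj C (2 * d)).
- rewrite mul2n -addnn; apply: dhomogM; first exact: dhomog_is_dhomog.
  by apply: map_mpoly_homog; apply: dhomog_is_dhomog.
- by apply: map_mpoly_homog; apply: dhomog_is_dhomog.
rewrite dehomM [in LHS]dehom_flip_form [in LHS]dehom_flip_form_conj.
rewrite dehom_map_form F_roots.
rewrite -scalerAl -scalerAr scalerA a_sqr -big_split; congr (_ *: _).
by apply: eq_bigr => t _; case: ifP => // _; rewrite mulrC.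
Qed.

Lemma flip_form_free : free [seq flip_form i | i : 'I_k.+1 <- enum 'I_k.+1].
Proof.
have -> : [seq flip_form i | i : 'I_k.+1 <- enum 'I_k.+1] =
  [tuple flip_form i | i < k.+1] by [].
apply/freeP => g g0 i.
have : g i * a = 0.
  apply: (flip_poly_free kd w_inj w_conj (g := fun i => g i * a)).
  have {}g0 : \sum_j g j *: flip_form j = 0.
    rewrite -[RHS]g0; apply: eq_bigr => j _.
    by rewrite -tnth_nth tnth_mktuple.
  have := dehom_lincomb g (fun j : 'I_k.+1 => flip_form j).
  rewrite g0 (_ : dehom _ = 0); last exact: raddf0.
  move=> lin0; rewrite [RHS]lin0; apply: eq_bigr => j _.
  by rewrite dehom_flip_form scalerA.
by move/eqP; rewrite mulf_eq0 (negPf a_neq0) orbF => /eqP.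
Qed.

(** Evaluating the Gram identity at the root w_t of f gives the relation required by
    [hermitian_relation_diag], up to the nonzero factor a^2. *)
Lemma flip_form_relation (c : 'M[C]_k.+1) :
  (forall i j, c j i = (c i j)^*) ->
  tens_mul (\sum_i \sum_j c i j *: tens (flip_form i) (flip_form j)) = fC ->
  forall i j, i != j -> c i j = 0.
Proof.
move=> cH cf; apply: (hermitian_relation_diag kd w_inj w_conj w_block) => // t td.
have := dehom_root td; rewrite -cf linear_sum raddf_sum horner_sum /=.
under eq_bigr => i _ do rewrite linear_sum raddf_sum horner_sum /=.
move=> c0; apply: (mulfI (mulf_neq0 a_neq0 a_neq0)); rewrite mulr0 -[RHS]c0.
rewrite mulr_sumr; apply: eq_bigr => i _; rewrite mulr_sumr; apply: eq_bigr => j _.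
rewrite linearZ /= tens_mul_tens dehomZ dehomM.
rewrite (dehom_flip_form i) (dehom_flip_form_conj j).
by rewrite hornerZ hornerM !hornerZ; ring.
Qed.

Lemma map_form_neq0 : fC != 0.
Proof.
have : dehomC fC != 0.
  rewrite dehom_map_form map_poly_eq0 -size_poly_eq0 size_dehom //.
  by rewrite gt_eqF.
by apply: contra_neq => ->; rewrite raddf0.
Qed.

End Roots.
End NonnegForm.

(** * Faces for the forms off the hypersurface *)

Theorem theorem3p12 (R : realType) (k d : nat) (k_gt0 : (0 < k)%N)
    (le_d : ('C(k.+1, 2) <= d)%N) :
  generic_nonneg (fun f : binform R (2 * d) =>
    exists F : set (herm_tensor R d),
      [/\ is_face (gram_spectrahedron f) F,
          is_simplex F,
          has_face_rank F k.+1,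
          has_dim F k
        & forall theta, extreme_point F theta -> has_rank theta 1]).
Proof.
have [h h_nc hP] := coeff_condition_of_roots (real_complex R)
  (configuration_neq0 R le_d).
exists [set f | h.@[fun i : 'I_(2 * d).+1 =>
  (f : {mpoly R[2]})@_(binmon (2 * d) i)] = 0]; split; first by exists h.
(* Where h is nonzero, so is the leading coefficient, and [configuration] is nonzero at every
   enumeration of the roots. *)
move=> f [f_ge0 noface]; apply/eqP/negPn/negP => /hP[/= lead_neq0 rootsP].
apply: noface.
have lead_gt0 : 0 < (f : {mpoly R[2]})@_(binmon (2 * d) (2 * d)).
  by rewrite lt_def lead_neq0 nonneg_form_lead.
have sF := size_dehom lead_neq0.
have F_ge0 t : 0 <= (dehom (f : {mpoly R[2]})).[t] by rewrite eval_dehom f_ge0.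
have [w F_roots] := nonneg_poly_factor F_ge0 sF.
have leadE : lead_coef (dehom (f : {mpoly R[2]})) =
    (f : {mpoly R[2]})@_(binmon (2 * d) (2 * d)).
  by rewrite lead_coefE sF coef_dehom.
rewrite leadE in F_roots.
(* The 2d roots in the order fixed by [configuration]. *)
pose z t := if (t < d)%N then w t else (w (t - d)%N)^*.
have zc t : z (d + t)%N = (w t)^* by rewrite /z ltnNge leq_addr /= addKn.
have f_roots : \sum_(i < (2 * d).+1)
    real_complex R ((f : {mpoly R[2]})@_(binmon (2 * d) i)) *: 'X^i =
  real_complex R ((f : {mpoly R[2]})@_(binmon (2 * d) (2 * d))) *:
    \prod_(i < 2 * d) ('X - (z i)%:P).
  transitivity (map_poly (real_complex R) (dehom (f : {mpoly R[2]}))).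
    rewrite dehomE rmorph_sum; apply: eq_bigr => i _ /=.
    by rewrite map_polyZ map_polyXn.
  rewrite F_roots; congr (_ *: _).
  rewrite -(big_mkord xpredT (fun i => 'X - (z i)%:P)).
  rewrite [RHS](big_cat_nat (n := d)) //=; last by lia.
  rewrite big_split; congr (_ * _).
    by apply: eq_big_nat => t /andP[_ td]; rewrite /z td.
  rewrite -[RHS]/(\prod_(0 + d <= i < 2 * d) ('X - (z i)%:P)) big_addn.
  rewrite mul2n -addnn addnK.
  by apply: eq_bigr => t _; rewrite addnC zc.
have [z_inj z_det] := mmap_configuration le_d (rootsP _ f_roots).
have w_inj s t : (s < d)%N -> (t < d)%N -> s != t -> w s != w t.
  by move=> sd td st; have := z_inj s t; rewrite /z sd td; apply=> //; lia.
(* The case s = t excludes real roots. *)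
have w_conj s t : (s < d)%N -> (t < d)%N -> w s != (w t)^*.
  by move=> sd td; have := z_inj s (d + t)%N; rewrite zc /z sd; apply; lia.
have w_block m : (m <= k)%N -> \det (block_eval_mx d w (Num.conj \o w) m) != 0.
  move=> mk; have := z_det m mk; congr (\det _ != 0); apply: eq_block_eval_mx.
  - by apply: leq_trans le_d; apply: leq_bin2l.
  - by move=> t td; rewrite /z td.
  - by move=> t td; rewrite zc.
pose p (i : 'I_k.+1) := flip_form f w i.
exists (convex_hull (fun i => rank_one (p i))); apply: rank_one_face.
- exact: map_form_neq0.
- exact: flip_form_free.
- by move=> i; apply: flip_form_gram.
- exact: flip_form_relation.
Qed.
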